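(* Let $H$ be a monoid, $N$ an abelian group (written multiplicatively), $E$ an admissible equivalence relation on $N\times H$ and $[\varphi]$ an equivalence class of actions compatible with $E$. Then the maps $\rho\colon \mathcal{H}^2(H,N,E,[\varphi])\to \mathrm{CExt}(H,N,E,[\varphi])$ (sending the class of a factor set $g$ to the isomorphism class of the extension $N\to (N\times H)/E^{\varphi}_g\to H$) and $\zeta\colon \mathrm{CExt}(H,N,E,[\varphi])\to\mathcal{H}^2(H,N,E,[\varphi])$ (sending the isomorphism class of an extension to the class of its associated factor sets) are mutually inverse, and hence give a bijection between the set $\mathrm{CExt}(H,N,E,[\varphi])$ and the abelian group $\mathcal{H}^2(H,N,E,[\varphi])$.
   Context: **Extensions.** An extension of monoids is a diagram $N\xrightarrow{k}G\xrightarrow{e}H$ of monoid homomorphisms in which $k$ is a kernel of $e$ (i.e. $k$ is injective with image $e^{-1}(1)$) and $e$ is a cokernel of $k$ (every monoid homomorphism $f\colon G\to M$ with $f(k(n))=1$ for all $n\in N$ factors uniquely as $f=\ell e$ with $\ell\colon H\to M$ a homomorphism; in particular $e$ is surjective). It is *cosetal* if whenever $e(g)=e(g')$ there is $n\in N$ with $k(n)g'=g$. Two extensions $(G,k,e)$, $(G',k',e')$ of $H$ by $N$ are isomorphic if there is a monoid isomorphism $f\colon G\to G'$ with $fk=k'$ and $e'f=e$. A *section* of $e$ is a function $s\colon H\to G$ (not necessarily a homomorphism) with $es=1_H$ and $s(1)=1$. **Admissible relations.** An equivalence relation $E$ (written $\sim$, classes $[n,h]$) on $N\times H$ is *admissible*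 if: (1) $(n,1)\sim(n',1)$ implies $n=n'$; (2) $(n,h)\sim(n',h')$ implies $h=h'$; (3) $(n,h)\sim(n',h)$ implies $(xn,h)\sim(xn',h)$ for all $x\in N$; (4) $(n,h)\sim(n',h)$ implies $(n,hx)\sim(n',hx)$ for all $x\in H$. **Compatible actions.** A function $\varphi\colon H\times N\to N$ is a *compatible action* with respect to $E$ if for all elements: (1) $(n_1,h)\sim(n_2,h)$ implies $[n_1\varphi(h,n),h]=[n_2\varphi(h,n),h]$; (2) $(n,h')\sim(n',h')$ implies $[\varphi(h,n),hh']=[\varphi(h,n'),hh']$; (3) $[\varphi(h,nn'),h]=[\varphi(h,n)\varphi(h,n'),h]$; (4) $[\varphi(hh',n),hh']=[\varphi(h,\varphi(h',n)),hh']$; (5) $[\varphi(h,1),h]=[1,h]$; (6) $[\varphi(1,n),1]=[n,1]$. Two compatible actions $\varphi,\varphi'$ are equivalent if $(\varphi(h,n),h)\sim(\varphi'(h,n),h)$ for all $h,n$; $[\varphi]$ is the equivalence class. **Data associated to a cosetal extension** $N\xrightarrow{k}G\xrightarrow{e}H$ with $N$ an abelian group. Choose a section $s$ of $e$. The associated admissible equivalence relation is: $(n,h)\sim(n',h')$ iff $k(n)s(h)=k(n')s(h')$. The associated class of compatible actions is obtained as follows: let $\mathrm{Eq}(e)=\{(g,g')\in G\times G: e(g)=e(g')\}$, choose a function $q\colon\mathrm{Eq}(e)\to N$ with $k(q(g,g'))g'=g$, put $\alpha(g,n)=q(gk(n),g)$ and $\varphi(h,n)=\alpha(s(h),n)$,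 and take the class $[\varphi]$. (These do not depend on the choices.) $\mathrm{CExt}(H,N,E,[\varphi])$ is the set of isomorphism classes of cosetal extensions of $H$ by $N$ whose associated data are $E$ and $[\varphi]$. **Factor sets.** A *factor set* with respect to $E$ and $\varphi$ is a function $g\colon H\times H\to N$ with $g(x,1)=1=g(1,x)$ and $(g(x,y)g(xy,z),xyz)\sim(\varphi(x,g(y,z))g(x,yz),xyz)$ for all $x,y,z\in H$; this depends only on $[\varphi]$. The set $\mathcal{F}^*(H,N,E,[\varphi])$ of factor sets is an abelian group under pointwise multiplication. Let $F$ be the congruence on it given by $g\sim_F g'$ iff $(g(h,h'),hh')\sim(g'(h,h'),hh')$ for all $h,h'\in H$, and $\mathcal{F}(H,N,E,[\varphi])=\mathcal{F}^*(H,N,E,[\varphi])/F$. A factor set is *inner* if it equals $\delta t$, where $\delta t(h,h')=\varphi(h,t(h'))\,t(hh')^{-1}\,t(h)$, for some function $t\colon H\to N$ with $t(1)=1$ and some representative $\varphi$ of $[\varphi]$. Let $\mathcal{IF}(H,N,E,[\varphi])$ be the subgroup of $\mathcal{F}(H,N,E,[\varphi])$ of $F$-classes of inner factor sets, and $\mathcal{H}^2(H,N,E,[\varphi])=\mathcal{F}(H,N,E,[\varphi])/\mathcal{IF}(H,N,E,[\varphi])$. **The maps.** For a factor set $g$, $(N\times H)/E^{\varphi}_g$ is the set $(N\times H)/E$ with multiplication $[n,h][n',h']=[n\varphi(h,n')g(h,h'),hh']$ and unit $[1,1]$; it gives the cosetal extension $N\to (N\times H)/E^{\varphi}_g\to H$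 with maps $n\mapsto[n,1]$ and $[n,h]\mapsto h$. The map $\rho$ sends the class of $g$ to the isomorphism class of this extension. Given a cosetal extension in $\mathrm{CExt}(H,N,E,[\varphi])$ and a section $s$, an *associated factor set* is a function $g_s\colon H\times H\to N$ with $g_s(x,1)=1=g_s(1,x)$ and $k(g_s(h,h'))s(hh')=s(h)s(h')$ for all $h,h'$. The map $\zeta$ sends the isomorphism class of an extension to the class in $\mathcal{H}^2(H,N,E,[\varphi])$ of any factor set associated to any of its sections (this is the class of factor sets that generate the extension via $\rho$). *)

(* Defs.v *)
From HB Require Import structures.
From mathcomp Require Import all_boot.
From mathcomp Require Import boolp.

Set Implicit Arguments.
Unset Strict Implicit.
Unset Printing Implicit Defensive.

Local Open Scope quotient_scope.
Local Open Scope group_scope.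

(* Monoid homomorphisms are [UMagmaMorphism.type G H] from
   mathcomp.boot.monoid: maps preserving [*] and [1].  MathComp has no
   structure for multiplicative abelian groups, hence the next one. *)

HB.mixin Record Group_isAbelian G of Group G := {
  mulgC : commutative (@mul G)
}.

#[short(type="abelianGroupType")]
HB.structure Definition AbelianGroup := {G of Group_isAbelian G & Group G}.

Section AbelianGroupTheory.
Variable A : abelianGroupType.
Implicit Types a b c d : A.

Lemma mulgCA a b c : a * (b * c) = b * (a * c).
Proof. by rewrite !mulgA (mulgC a). Qed.

Lemma mulgAC a b c : a * b * c = a * c * b.
Proof. by rewrite -!mulgA (mulgC b). Qed.

Lemma mulgACA a b c d : a * b * (c * d) = a * c * (b * d).
Proof. by rewrite -!mulgA; congr (_ * _); rewrite mulgCA. Qed.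

Lemma invgMC a b : (a * b)^-1 = a^-1 * b^-1.
Proof. by rewrite invgM mulgC. Qed.
End AbelianGroupTheory.

Record congruence (A : abelianGroupType) := Congruence {
  cong_rel :> equiv_rel A;
  congM : forall x x' y y',
    cong_rel x x' -> cong_rel y y' -> cong_rel (x * y) (x' * y')
}.

Section CongruenceQuotient.
Variables (A : abelianGroupType) (R : congruence A).

Lemma congV x y : R x y -> R x^-1 y^-1.
Proof.
move=> Rxy; have Rc z : R z z by apply: equiv_refl.
have := congM (congM (Rc x^-1) Rxy) (Rc y^-1).
by rewrite mulVg mul1g mulgK equiv_sym.
Qed.

Definition cong_quot := {eq_quot R}.
HB.instance Definition _ := Choice.on cong_quot.
HB.instance Definition _ := EqQuotient.on cong_quot.

Definition cq_mul (x y : cong_quot) : cong_quot := \pi_cong_quot (repr x * repr y).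
Definition cq_one : cong_quot := \pi_cong_quot 1.
Definition cq_inv (x : cong_quot) : cong_quot := \pi_cong_quot (repr x)^-1.

Lemma cq_eqP x y : (\pi_cong_quot x = \pi_cong_quot y) <-> R x y.
Proof. by split=> [/eqmodP|Rxy] //; apply/eqmodP. Qed.

Lemma cq_repr x : R (repr (\pi_cong_quot x)) x.
Proof. by apply/cq_eqP; rewrite reprK. Qed.

Lemma cq_piM x y : \pi_cong_quot (x * y) = cq_mul (\pi x) (\pi y).
Proof. by apply/cq_eqP; rewrite equiv_sym; apply: congM; apply: cq_repr. Qed.

Lemma cq_piV x : \pi_cong_quot x^-1 = cq_inv (\pi x).
Proof. by apply/cq_eqP; rewrite equiv_sym; apply: congV; apply: cq_repr. Qed.

Fact cq_mulC : commutative cq_mul.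
Proof. by move=> x y; rewrite -[x]reprK -[y]reprK -!cq_piM mulgC. Qed.

Fact cq_mulA : associative cq_mul.
Proof.
move=> x y z; rewrite -[x]reprK -[y]reprK -[z]reprK.
rewrite -(cq_piM (repr y) (repr z)) -(cq_piM (repr x) (repr y)).
by rewrite -(cq_piM (repr x) (_ * _)) -(cq_piM (_ * _) (repr z)) mulgA.
Qed.

Fact cq_mul1g : left_id cq_one cq_mul.
Proof. by move=> x; rewrite -[x]reprK -cq_piM mul1g. Qed.

Fact cq_mulg1 : right_id cq_one cq_mul.
Proof. by move=> x; rewrite cq_mulC cq_mul1g. Qed.

Fact cq_mulVg : left_inverse cq_one cq_inv cq_mul.
Proof. by move=> x; rewrite -[x]reprK -cq_piV -cq_piM mulVg. Qed.

Fact cq_mulgV : right_inverse cq_one cq_inv cq_mul.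
Proof. by move=> x; rewrite cq_mulC cq_mulVg. Qed.

HB.instance Definition _ :=
  isGroup.Build cong_quot cq_mulA cq_mul1g cq_mulg1 cq_mulVg cq_mulgV.
HB.instance Definition _ := Group_isAbelian.Build cong_quot cq_mulC.

End CongruenceQuotient.

Section SubgroupCongruence.
Variables (A : abelianGroupType) (S : groupClosed A).

Definition subgroup_rel : rel A := fun x y => x / y \in S.

Lemma subgroup_equiv : equiv_class_of subgroup_rel.
Proof.
split=> [x|x y|y x z]; rewrite /subgroup_rel ?divgg ?gpred1 //.
  by rewrite gpredFC.
by move=> Sxy Syz; rewrite -(divgKA y) gpredM.
Qed.

Lemma subgroup_congM x x' y y' : subgroup_rel x x' -> subgroup_rel y y' ->
  subgroup_rel (x * y) (x' * y').
Proof. by rewrite /subgroup_rel invgMC mulgACA => Sx Sy; rewrite gpredM. Qed.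

Definition subgroup_cong : congruence A :=
  @Congruence A (EquivRelPack subgroup_equiv) subgroup_congM.
End SubgroupCongruence.

Section Extensions.
Variables N H : monoidType.

Definition is_kernel (G : monoidType) (k : UMagmaMorphism.type N G)
    (e : UMagmaMorphism.type G H) : Prop :=
  injective k /\ (forall g, e g = 1 <-> exists n, k n = g).

Definition is_cokernel (G : monoidType) (k : UMagmaMorphism.type N G)
    (e : UMagmaMorphism.type G H) : Prop :=
  forall (M : monoidType) (f : UMagmaMorphism.type G M),
    (forall n, f (k n) = 1) ->
  exists2 l : UMagmaMorphism.type H M, f =1 l \o e &
    forall l' : UMagmaMorphism.type H M, f =1 l' \o e -> l' =1 l.

Record extension := Extension {
  ext_mid :> monoidType;
  ext_k : UMagmaMorphism.type N ext_mid;
  ext_e : UMagmaMorphism.type ext_mid H;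
  ext_kerP : is_kernel ext_k ext_e;
  ext_cokerP : is_cokernel ext_k ext_e
}.

Definition cosetal (X : extension) : Prop :=
  forall g g' : X, ext_e X g = ext_e X g' -> exists n, ext_k X n * g' = g.

Definition ext_iso (X Y : extension) : Prop :=
  exists f : UMagmaMorphism.type X Y,
    [/\ bijective f, forall n, f (ext_k X n) = ext_k Y n &
        forall g, ext_e Y (f g) = ext_e X g].

Definition is_section (X : extension) (s : H -> X) : Prop :=
  (forall h, ext_e X (s h) = h) /\ s 1 = 1.

(* A function q : Eq(e) -> N with k (q (g, g')) g' = g, represented by a total
   function on G x G whose values outside Eq(e) are irrelevant. *)
Definition is_quotient_fun (X : extension) (q : X -> X -> N) : Prop :=
  forall g g', ext_e X g = ext_e X g' -> ext_k X (q g g') * g' = g.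

(* h, n |-> alpha (s h, n), where alpha (g, n) = q (g k(n), g). *)
Definition section_action (X : extension) (s : H -> X) (q : X -> X -> N)
  (h : H) (n : N) : N := q (s h * ext_k X n) (s h).

End Extensions.

(* Relations are boolean, so that MathComp's quotient types apply; under the
   classical axioms in use this is no restriction. *)
Record admissibleRel (N : abelianGroupType) (H : monoidType) := AdmissibleRel {
  adm_rel :> equiv_rel (N * H)%type;
  adm_inj : forall n n', adm_rel (n, 1) (n', 1) -> n = n';
  adm_snd : forall n n' h h', adm_rel (n, h) (n', h') -> h = h';
  adm_mull : forall x n n' h,
    adm_rel (n, h) (n', h) -> adm_rel (x * n, h) (x * n', h);
  adm_mulr : forall n n' h x,
    adm_rel (n, h) (n', h) -> adm_rel (n, h * x) (n', h * x)
}.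

Section AdmissibleTheory.
Variables (N : abelianGroupType) (H : monoidType) (E : admissibleRel N H).
Implicit Types (a b c n : N) (h x y z : H).

Lemma admE p : E p p. Proof. exact: equiv_refl. Qed.

Lemma adm_eq n n' h : n = n' -> E (n, h) (n', h).
Proof. by move->; apply: equiv_refl. Qed.

Lemma adm_sym p q : E p q -> E q p.
Proof. by rewrite equiv_sym. Qed.

Lemma adm_trans q p r : E p q -> E q r -> E p r.
Proof. exact: equiv_trans. Qed.

Lemma admM a a' b b' h :
  E (a, h) (a', h) -> E (b, h) (b', h) -> E (a * b, h) (a' * b', h).
Proof.
move=> Ea Eb; apply: (@adm_trans (a * b', h)); first exact: adm_mull.
by rewrite !(mulgC _ b'); apply: adm_mull.
Qed.

Lemma admMI a b c h : E (a * b, h) (a * c, h) -> E (b, h) (c, h).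
Proof. by move/(adm_mull a^-1); rewrite !mulKg. Qed.

Lemma admV a b h : E (a, h) (b, h) -> E (a^-1, h) (b^-1, h).
Proof.
move=> Eab; apply: adm_sym; apply: (@admMI (a * b)).
by rewrite mulgK mulgAC mulgV mul1g.
Qed.

Record compatible (phi : H -> N -> N) : Prop := Compatible {
  cmp_rel : forall n1 n2 n h, E (n1, h) (n2, h) ->
    E (n1 * phi h n, h) (n2 * phi h n, h);
  cmp_arg : forall n n' h h', E (n, h') (n', h') ->
    E (phi h n, h * h') (phi h n', h * h');
  cmp_mul : forall h n n', E (phi h (n * n'), h) (phi h n * phi h n', h);
  cmp_act : forall h h' n,
    E (phi (h * h') n, h * h') (phi h (phi h' n), h * h');
  cmp_act1 : forall h, E (phi h 1, h) (1, h);
  cmp_1act : forall n, E (phi 1 n, 1) (n, 1)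
}.

Record compatibleAction := CompatibleAction {
  act_fun :> H -> N -> N;
  act_compat : compatible act_fun
}.

HB.instance Definition _ := gen_eqMixin compatibleAction.
HB.instance Definition _ := gen_choiceMixin compatibleAction.

Definition act_rel : rel compatibleAction :=
  fun phi psi => `[< forall h n, E (phi h n, h) (psi h n, h) >].

Lemma act_equiv : equiv_class_of act_rel.
Proof.
split=> [phi|phi psi|psi phi chi].
- by apply/asboolP => h n; apply: admE.
- by apply/asboolP/asboolP => Ep h n; apply: adm_sym.
- move=> /asboolP E1 /asboolP E2; apply/asboolP => h n.
  exact: adm_trans (E1 h n) (E2 h n).
Qed.

Canonical act_equiv_rel := EquivRelPack act_equiv.

Definition actionClass := {eq_quot act_equiv_rel}.
HB.instance Definition _ := Choice.on actionClass.
HB.instance Definition _ := EqQuotient.on actionClass.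

Definition action_class (phi : compatibleAction) : actionClass := \pi phi.

Lemma action_classP (phi psi : compatibleAction) :
  action_class phi = action_class psi <->
  forall h n, E (phi h n, h) (psi h n, h).
Proof. by split=> [/eqmodP/asboolP|Ep] //; apply/eqmodP/asboolP. Qed.

Lemma action_classK (Phi : actionClass) : action_class (repr Phi) = Phi.
Proof. exact: reprK. Qed.

Lemma admC n n' h x y : E (n, h) (n', h) -> h * x = y -> E (n, y) (n', y).
Proof. by move=> En <-; apply: adm_mulr. Qed.

Lemma cmpV (phi : compatibleAction) h n :
  E (phi h n^-1, h) ((phi h n)^-1, h).
Proof.
have C := act_compat phi.
apply: (@admMI (phi h n)); rewrite mulgV.
apply: adm_trans (cmp_act1 C h); rewrite -(mulgV n).
exact/adm_sym/cmp_mul.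
Qed.

Lemma cmp_1actE (phi : compatibleAction) n : phi 1 n = n.
Proof. exact: adm_inj (cmp_1act (act_compat phi) n). Qed.

End AdmissibleTheory.

Arguments action_class {N H E} phi.

Section FactorSets.
Variables (N : abelianGroupType) (H : monoidType) (E : admissibleRel N H).
Implicit Types (phi : compatibleAction E) (Phi : actionClass E).

Definition is_factor_set_for phi (g : H -> H -> N) : Prop :=
  (forall x, g x 1 = 1 /\ g 1 x = 1) /\
  (forall x y z, E (g x y * g (x * y) z, x * y * z)
                   (phi x (g y z) * g x (y * z), x * y * z)).

Definition is_factor_set Phi (g : H -> H -> N) : Prop :=
  forall phi, action_class phi = Phi -> is_factor_set_for phi g.

Lemma factor_set_class phi psi g : action_class phi = action_class psi ->
  is_factor_set_for phi g -> is_factor_set_for psi g.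
Proof.
move=> /action_classP Ep [g1 gc]; split=> // x y z.
apply: adm_trans (gc x y z) _; apply: admM; last exact: admE.
by rewrite -mulgA; apply: adm_mulr.
Qed.

Lemma is_factor_setP phi g :
  is_factor_set (action_class phi) g <-> is_factor_set_for phi g.
Proof.
split=> [|gphi psi psiE]; first exact.
exact: factor_set_class (esym psiE) gphi.
Qed.

Record factor_set Phi := FactorSet {
  fs_fun :> H -> H -> N;
  fs_prop : is_factor_set Phi fs_fun
}.

HB.instance Definition _ Phi := gen_eqMixin (factor_set Phi).
HB.instance Definition _ Phi := gen_choiceMixin (factor_set Phi).

Lemma factor_set_eq Phi (g g' : factor_set Phi) :
  (forall x y, g x y = g' x y) -> g = g'.
Proof.
case: g g' => [g gP] [g' gP'] /= eg.
have {}eg : g = g' by apply/funext=> x; apply/funext=> y.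
by case: _ / eg gP' => gP'; congr FactorSet; apply: Prop_irrelevance.
Qed.

Lemma factor_setP phi (g : factor_set (action_class phi)) :
  is_factor_set_for phi g.
Proof. exact: fs_prop. Qed.

Section FactorSetGroup.
Variable Phi : actionClass E.
Implicit Types g : factor_set Phi.

Fact fs_one_subproof : is_factor_set Phi (fun _ _ => 1).
Proof.
move=> phi _; split=> // x y z; rewrite !mulg1 -mulgA.
exact/adm_mulr/adm_sym/(cmp_act1 (act_compat phi)).
Qed.
Definition fs_one := FactorSet fs_one_subproof.

Fact fs_mul_subproof g g' : is_factor_set Phi (fun x y => g x y * g' x y).
Proof.
move=> phi phiE; have C := act_compat phi.
have [[g1 gc] [g1' gc']] := (fs_prop g phiE, fs_prop g' phiE).
split=> [x|x y z].
  by have [[-> ->] [-> ->]] := (g1 x, g1' x); rewrite mulg1.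
rewrite mulgACA; apply: adm_trans (admM (gc x y z) (gc' x y z)) _.
rewrite mulgACA; apply: admM; last exact: admE.
by rewrite -mulgA; apply/adm_mulr/adm_sym/(cmp_mul C).
Qed.
Definition fs_mul g g' := FactorSet (fs_mul_subproof g g').

Fact fs_inv_subproof g : is_factor_set Phi (fun x y => (g x y)^-1).
Proof.
move=> phi phiE; have [g1 gc] := fs_prop g phiE.
split=> [x|x y z]; first by have [-> ->] := g1 x; rewrite invg1.
rewrite -invgMC; apply: adm_trans (admV (gc x y z)) _.
rewrite invgMC; apply: admM; last exact: admE.
by rewrite -mulgA; apply/adm_mulr/adm_sym/cmpV.
Qed.
Definition fs_inv g := FactorSet (fs_inv_subproof g).

Fact fs_mulA : associative fs_mul.
Proof. by move=> f g h; apply: factor_set_eq => x y /=; rewrite mulgA. Qed.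
Fact fs_mulC : commutative fs_mul.
Proof. by move=> f g; apply: factor_set_eq => x y /=; rewrite mulgC. Qed.
Fact fs_mul1g : left_id fs_one fs_mul.
Proof. by move=> f; apply: factor_set_eq => x y /=; rewrite mul1g. Qed.
Fact fs_mulg1 : right_id fs_one fs_mul.
Proof. by move=> f; rewrite fs_mulC fs_mul1g. Qed.
Fact fs_mulVg : left_inverse fs_one fs_inv fs_mul.
Proof. by move=> f; apply: factor_set_eq => x y /=; rewrite mulVg. Qed.
Fact fs_mulgV : right_inverse fs_one fs_inv fs_mul.
Proof. by move=> f; rewrite fs_mulC fs_mulVg. Qed.

HB.instance Definition _ :=
  isGroup.Build (factor_set Phi) fs_mulA fs_mul1g fs_mulg1 fs_mulVg fs_mulgV.
HB.instance Definition _ := Group_isAbelian.Build (factor_set Phi) fs_mulC.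

Definition F_rel : rel (factor_set Phi) :=
  fun g g' => `[< forall h h', E (g h h', h * h') (g' h h', h * h') >].

Lemma F_equiv : equiv_class_of F_rel.
Proof.
split=> [f|f g|g f k].
- by apply/asboolP => h n; apply: admE.
- by apply/asboolP/asboolP => Ep h n; apply: adm_sym.
- move=> /asboolP E1 /asboolP E2; apply/asboolP => h n.
  exact: adm_trans (E1 h n) (E2 h n).
Qed.

Canonical F_equiv_rel := EquivRelPack F_equiv.

Lemma F_congM f f' g g' :
  F_equiv_rel f f' -> F_equiv_rel g g' -> F_equiv_rel (f * g) (f' * g').
Proof.
move=> /asboolP Ef /asboolP Eg; apply/asboolP => h h'.
exact: admM (Ef h h') (Eg h h').
Qed.

Definition F_cong := @Congruence (factor_set Phi) F_equiv_rel F_congM.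

Definition Fgroup := cong_quot F_cong.
HB.instance Definition _ := AbelianGroup.on Fgroup.
HB.instance Definition _ := EqQuotient.on Fgroup.

Definition Fclass g : Fgroup := \pi_Fgroup g.

Lemma FclassP g g' : Fclass g = Fclass g' <->
  forall h h', E (g h h', h * h') (g' h h', h * h').
Proof.
by split=> [/(@cq_eqP _ F_cong)/asboolP|Eg] //; apply/(@cq_eqP _ F_cong)/asboolP.
Qed.

Lemma FclassM g g' : Fclass (g * g') = Fclass g * Fclass g'.
Proof. exact: cq_piM. Qed.

Lemma FclassV g : Fclass g^-1 = (Fclass g)^-1.
Proof. exact: cq_piV. Qed.

Definition delta (phi : compatibleAction E) (t : H -> N) (h h' : H) : N :=
  phi h (t h') * (t (h * h'))^-1 * t h.

Definition inner (g : factor_set Phi) : Prop :=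
  exists (phi : compatibleAction E) (t : H -> N),
    [/\ action_class phi = Phi, t 1 = 1 & forall h h', g h h' = delta phi t h h'].

Definition IF : {pred Fgroup} :=
  fun c => `[< exists2 g, inner g & Fclass g = c >].

(* [delta phi t] is normalized only if [phi x 1 = 1]; every class contains
   such an action. *)
Section NormalizedAction.
Variable phi : compatibleAction E.

Definition normal_fun (h : H) (n : N) : N := if n == 1 then 1 else phi h n.

Lemma normal_funE h n : E (normal_fun h n, h) (phi h n, h).
Proof.
rewrite /normal_fun; case: eqP => [->|_]; last exact: admE.
exact/adm_sym/(cmp_act1 (act_compat phi)).
Qed.

Fact normal_compat : compatible E normal_fun.
Proof.
have C := act_compat phi; split.
- by move=> n1 n2 n h En; apply: admM => //; apply: admE.
- move=> n n' h h' En.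
  apply: adm_trans (adm_mulr h' (normal_funE h n)) _.
  apply: adm_trans (cmp_arg C h En) _.
  exact/adm_sym/adm_mulr/normal_funE.
- move=> h n n'; apply: adm_trans (normal_funE _ _) _.
  apply: adm_trans (cmp_mul C _ _ _) _.
  by apply: admM; apply/adm_sym/normal_funE.
- move=> h h' n; apply: adm_trans (normal_funE _ _) _.
  apply: adm_trans (cmp_act C _ _ _) _.
  apply: adm_trans (cmp_arg C h (adm_sym (normal_funE h' n))) _.
  exact/adm_sym/adm_mulr/normal_funE.
- by move=> h; rewrite /normal_fun eqxx; apply: admE.
- by move=> n; apply: adm_trans (normal_funE _ _) (cmp_1act C n).
Qed.

Definition normal_action := CompatibleAction normal_compat.

Lemma normal_class : action_class normal_action = action_class phi.
Proof. by apply/action_classP=> h n; apply: normal_funE. Qed.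

Lemma normal_act1 h : normal_action h 1 = 1.
Proof. by rewrite /= /normal_fun eqxx. Qed.

End NormalizedAction.

Lemma delta_factor_set (phi : compatibleAction E) t : action_class phi = Phi ->
  (forall h, phi h 1 = 1) -> t 1 = 1 -> is_factor_set Phi (delta phi t).
Proof.
move=> <- p1 t1; have C := act_compat phi; apply/is_factor_setP; split=> [x|x y z].
  rewrite /delta t1 p1 mulg1 mul1g mulVg mul1g.
  by rewrite cmp_1actE mulg1 mulgV.
have Ex a b : E (phi x (a * b), x * y * z) (phi x a * phi x b, x * y * z).
  by rewrite -(mulgA x); apply/adm_mulr/(cmp_mul C).
rewrite /delta.
apply: (@adm_trans _ _ _ (phi x (t y) * t x *
   (phi x (phi y (t z)) * (t (x * y * z))^-1), x * y * z)).
  rewrite (_ : _ * _ = phi x (t y) * t x *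
    (phi (x * y) (t z) * (t (x * y * z))^-1)); last first.
    rewrite (mulgAC (phi x (t y))) -!mulgA; congr (_ * (_ * _)).
    by rewrite mulgCA (mulgCA (t (x * y))^-1) mulVg mulg1.
  apply/adm_mull; apply: admM; last exact: admE.
  exact/adm_mulr/(cmp_act C).
apply: adm_sym.
have E1 : E (phi x (phi y (t z) * (t (y * z))^-1 * t y), x * y * z)
   (phi x (phi y (t z)) * (phi x (t (y * z)))^-1 * phi x (t y), x * y * z).
  apply: adm_trans (Ex _ _) _; apply: admM; last exact: admE.
  apply: adm_trans (Ex _ _) _; apply: admM; first exact: admE.
  by rewrite -(mulgA x); apply/adm_mulr/cmpV.
apply: adm_trans (admM E1 (admE _ _)) _; apply: adm_eq.
rewrite (mulgA x); move: (t (x * y * z))^-1 (phi x (t y)) => T a.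
rewrite (mulgAC _ _ a) -[LHS]mulgA -(mulgA (phi x (t (y * z)))) mulKg.
by rewrite (mulgC _ a) (mulgC T) mulgACA.
Qed.

Lemma delta_class (phi psi : compatibleAction E) t h h' :
  action_class phi = action_class psi ->
  E (delta phi t h h', h * h') (delta psi t h h', h * h').
Proof.
move=> /action_classP Ep; apply: admM; last exact: admE.
by apply: admM; [apply: adm_mulr | apply: admE].
Qed.

Lemma deltaM (phi : compatibleAction E) t t' h h' :
  E (delta phi (fun x => t x * t' x) h h', h * h')
    (delta phi t h h' * delta phi t' h h', h * h').
Proof.
rewrite /delta [X in E _ (X, _)]mulgACA; apply: admM; last exact: admE.
rewrite [X in E _ (X, _)]mulgACA -invgMC; apply: admM; last exact: admE.
exact/adm_mulr/(cmp_mul (act_compat phi)).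
Qed.

Lemma deltaV (phi : compatibleAction E) t h h' :
  E (delta phi (fun x => (t x)^-1) h h', h * h')
    ((delta phi t h h')^-1, h * h').
Proof.
rewrite /delta !invgMC; apply: admM; last exact: admE.
by apply: admM; [apply/adm_mulr/cmpV | apply: admE].
Qed.

Lemma IFP g (phi : compatibleAction E) (t : H -> N) :
  action_class phi = Phi -> t 1 = 1 ->
  (forall h h', E (g h h', h * h') (delta phi t h h', h * h')) ->
  Fclass g \in IF.
Proof.
move=> phiE t1 gE; have nE := etrans (normal_class phi) phiE.
apply/asboolP.
exists (FactorSet (delta_factor_set nE (normal_act1 phi) t1)).
  by exists (normal_action phi), t.
apply/FclassP=> h h'; apply: adm_sym; apply: adm_trans (gE h h') _.
exact/delta_class/esym/normal_class.
Qed.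

Fact IF_1 : 1 \in IF.
Proof.
apply: (@IFP 1 (repr Phi) (fun=> 1)) => //; first exact: action_classK.
move=> h h'; rewrite /delta !mulg1 invg1 mulg1.
exact/adm_mulr/adm_sym/(cmp_act1 (act_compat _)).
Qed.

Fact IF_M : mulg_closed IF.
Proof.
move=> _ _ /asboolP[g [phi [t [phiE t1 gE]]] <-]
  /asboolP[g' [psi [t' [psiE t1' gE']]] <-].
rewrite -FclassM; apply: (@IFP _ phi (fun x => t x * t' x)) => //.
  by rewrite t1 t1' mulg1.
move=> h h'; rewrite /= gE gE'; apply: adm_sym.
apply: adm_trans (deltaM _ _ _ _ _) _.
by apply: admM; [apply: admE | apply: delta_class; rewrite phiE].
Qed.

Fact IF_V : invg_closed IF.
Proof.
move=> _ /asboolP[g [phi [t [phiE t1 gE]]] <-].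
rewrite -FclassV; apply: (@IFP _ phi (fun x => (t x)^-1)) => //.
  by rewrite t1 invg1.
by move=> h h'; rewrite /= gE; apply/adm_sym/deltaV.
Qed.

HB.instance Definition _ := isMulClosed.Build Fgroup IF IF_M.
HB.instance Definition _ := isMul1Closed.Build Fgroup IF IF_1.
HB.instance Definition _ := isInvClosed.Build Fgroup IF IF_V.

Definition H2 := cong_quot (subgroup_cong IF).
HB.instance Definition _ := AbelianGroup.on H2.
HB.instance Definition _ := EqQuotient.on H2.

Definition H2class g : H2 := \pi_H2 (Fclass g).

Lemma H2classP g g' : H2class g = H2class g' <-> Fclass g / Fclass g' \in IF.
Proof. exact: (@cq_eqP _ (subgroup_cong IF)). Qed.

Lemma H2class_surj (c : H2) : exists g, H2class g = c.
Proof. by exists (repr (repr c : Fgroup)); rewrite /H2class /Fclass !reprK. Qed.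

End FactorSetGroup.
End FactorSets.

Section BasicExtensions.
Variables N H : monoidType.

Definition mk_hom (G K : monoidType) (f : G -> K) (fP : monoid_morphism f) :
    UMagmaMorphism.type G K :=
  let m := isUMagmaMorphism.Build G K f fP in HB.pack f m.

Fact compose_morphism (G K L : monoidType) (f : UMagmaMorphism.type K L)
  (g : UMagmaMorphism.type G K) : monoid_morphism (f \o g).
Proof. by split=> [|x y] /=; rewrite ?gmulf1 ?gmulfM. Qed.

Definition compose_hom (G K L : monoidType) (f : UMagmaMorphism.type K L)
    (g : UMagmaMorphism.type G K) : UMagmaMorphism.type G L :=
  mk_hom (compose_morphism f g).

Lemma ext_iso_refl (X : extension N H) : ext_iso X X.
Proof.
exists (@mk_hom X X id (erefl, fun _ _ => erefl)); split=> //.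
by exists id.
Qed.

Lemma ext_iso_sym (X Y : extension N H) : ext_iso X Y -> ext_iso Y X.
Proof.
case=> f [[f' fK f'K] fk fe].
exists (@mk_hom Y X f' (can2_gmulf1 fK f'K, can2_gmulfM fK f'K)); split.
- by exists f.
- by move=> n; rewrite -fk; apply: fK.
- by move=> g; rewrite -[in RHS](f'K g) fe.
Qed.

Lemma ext_iso_trans (Y X Z : extension N H) :
  ext_iso X Y -> ext_iso Y Z -> ext_iso X Z.
Proof.
case=> f [bf fk fe] [g [bg gk ge]]; exists (compose_hom g f); split.
- exact: bij_comp.
- by move=> n; rewrite /= fk gk.
- by move=> x; rewrite /= ge fe.
Qed.

Section Surjectivity.
Variable X : extension N H.

Definition ext_im : pred H := fun h => `[< exists g, ext_e X g = h >].

Fact ext_im_closed : monoid_closed ext_im.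
Proof.
split=> [|_ _ /asboolP[x <-] /asboolP[y <-]]; apply/asboolP.
  by exists 1; apply: gmulf1.
by exists (x * y); apply: gmulfM.
Qed.

Definition ext_im_sub := {h | ext_im h}.
HB.instance Definition _ := [isSub of ext_im_sub for (@sval _ _)].
HB.instance Definition _ := [Choice of ext_im_sub by <:].
HB.instance Definition _ :=
  SubChoice_isSubMonoid.Build H ext_im ext_im_sub ext_im_closed.

Lemma ext_e_surj h : exists g, ext_e X g = h.
Proof.
pose f (g : X) : ext_im_sub := Sub (ext_e X g) (asboolT (ex_intro _ g erefl)).
have fE g : val (f g) = ext_e X g by [].
have fP : monoid_morphism f.
  by split=> [|x y]; apply: val_inj; rewrite fE ?gmulf1 ?gmulfM.
have ek n : ext_e X (ext_k X n) = 1.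
  by apply/(ext_kerP X).2; exists n.
have [|l lE _] := @ext_cokerP _ _ X _ (mk_hom fP).
  by move=> n; apply: val_inj; rewrite /= ek.
have [|l' l'E l'U] := @ext_cokerP _ _ X _ (ext_e X); first exact: ek.
have idE := l'U (@mk_hom H H id (erefl, fun _ _ => erefl)) (fun=> erefl).
pose v : UMagmaMorphism.type ext_im_sub H :=
  @mk_hom _ _ (val : ext_im_sub -> H) (erefl, fun _ _ => erefl).
have vE := l'U (compose_hom v l).
have /(_ h) := vE (fun g => congr1 val (lE g)).
by rewrite -idE /= => <-; apply/asboolP/(valP (l h)).
Qed.
End Surjectivity.

Lemma ext_ek (X : extension N H) n : ext_e X (ext_k X n) = 1.
Proof. by apply/(ext_kerP X).2; exists n. Qed.

Lemma ext_section (X : extension N H) : exists s : H -> X, is_section s.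
Proof.
exists (fun h => if h == 1 then 1 else projT1 (cid (ext_e_surj X h))).
split=> [h|]; last by rewrite eqxx.
by case: eqP => [->|_]; [apply: gmulf1 | case: cid].
Qed.

Lemma ext_quotient_fun (X : extension N H) : cosetal X ->
  exists q : X -> X -> N, is_quotient_fun q.
Proof.
move=> cX; have ex g g' : exists n, ext_e X g = ext_e X g' -> ext_k X n * g' = g.
  by case: (pselect (ext_e X g = ext_e X g')) => [/cX[n]|] ?; [exists n|exists 1].
by exists (fun g g' => projT1 (cid (ex g g'))) => g g'; case: cid.
Qed.

End BasicExtensions.

Section CosetalExtensions.
Variables (N : abelianGroupType) (H : monoidType) (E : admissibleRel N H).
Implicit Types (phi : compatibleAction E) (Phi : actionClass E).

(* By [data_rel] and [data_act] below, the data do not depend on the choice of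
   s and q. *)
Definition has_data (X : extension N H) Phi : Prop :=
  exists (s : H -> X) (q : X -> X -> N),
    [/\ is_section s,
        is_quotient_fun q,
        forall n n' h h',
          E (n, h) (n', h') <-> ext_k X n * s h = ext_k X n' * s h' &
        exists2 phi, action_class phi = Phi & act_fun phi = section_action s q].

Record cosetal_ext Phi := CosetalExt {
  cx_ext :> extension N H;
  cx_cosetal : cosetal cx_ext;
  cx_data : has_data cx_ext Phi
}.

(* CExt is the set of isomorphism classes, as classes [cosetal_ext Phi -> Prop];
   MathComp's quotients need a choiceType, whose universe is too small to
   contain [cosetal_ext]. *)
Definition iso_class Phi (X : cosetal_ext Phi) : cosetal_ext Phi -> Prop :=
  fun Y => ext_iso X Y.

Record CExt Phi := IsoClass {
  cext_mem :> cosetal_ext Phi -> Prop;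
  cext_ex : exists X, cext_mem = iso_class X
}.

Definition cext_class Phi (X : cosetal_ext Phi) : CExt Phi :=
  IsoClass (ex_intro _ X erefl).

Lemma CExt_eq Phi (C D : CExt Phi) : cext_mem C = cext_mem D -> C = D.
Proof.
case: C D => [C CP] [D DP] /= CD; case: _ / CD DP => DP.
by congr IsoClass; apply: Prop_irrelevance.
Qed.

Lemma cext_classP Phi (X Y : cosetal_ext Phi) :
  cext_class X = cext_class Y <-> ext_iso X Y.
Proof.
split=> [/(congr1 (fun C : CExt Phi => C Y)) /= eXY|iXY].
  by rewrite -/(iso_class X Y) eXY; apply: ext_iso_refl.
apply: CExt_eq; apply/funext=> Z /=; rewrite propeqE; split.
  by apply: ext_iso_trans; apply: ext_iso_sym.
exact: ext_iso_trans.
Qed.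

Lemma cext_class_surj Phi (C : CExt Phi) : exists X, cext_class X = C.
Proof. by have [X CX] := cext_ex C; exists X; apply: CExt_eq. Qed.

Section Independence.
Variables (Phi : actionClass E) (X : cosetal_ext Phi).
Notation k := (ext_k X).
Notation e := (ext_e X).

Lemma ext_kC n n' : k n * k n' = k n' * k n.
Proof. by rewrite -!gmulfM mulgC. Qed.

Lemma ext_kI n (x y : X) : k n * x = k n * y -> x = y.
Proof.
by move/(congr1 (mul (k n^-1))); rewrite !mulgA -!gmulfM mulVg gmulf1 !mul1g.
Qed.

Lemma data_rel (s : H -> X) : is_section s -> forall n n' h h',
  E (n, h) (n', h') <-> k n * s h = k n' * s h'.
Proof.
case: (cx_data X) => s0 [q [[s0e s01] _ s0E _]] [se s1] n n' h h'.
have [u uE] : exists u, k u * s0 h = s h by apply: cx_cosetal; rewrite se s0e.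
split=> [Enn|].
  have hh := adm_snd Enn; move: Enn; rewrite -hh => /s0E Enn.
  by rewrite -uE !mulgA !(ext_kC _ u) -!mulgA Enn.
move=> kk; have hh : h = h'.
  have := congr1 e kk; rewrite !gmulfM !ext_ek !mul1g /= !se.
  exact.
move: kk; rewrite -hh -uE !mulgA !(ext_kC _ u) -!mulgA => /ext_kI.
by move/s0E.
Qed.

Lemma data_act (s : H -> X) phi : is_section s -> action_class phi = Phi ->
  forall h n, s h * k n = k (phi h n) * s h.
Proof.
case: (cx_data X) => s0 [q [[s0e s01] qE s0E [psi psiE psiq]]] [se s1] phiE h n.
have Epsi := (action_classP psi phi).1 (etrans psiE (esym phiE)).
have [u uE] : exists u, k u * s0 h = s h by apply: cx_cosetal; rewrite se s0e.
have s0n : s0 h * k n = k (phi h n) * s0 h.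
  have /s0E <- := Epsi h n; rewrite psiq /section_action qE //.
  by rewrite gmulfM ext_ek mulg1.
by rewrite -uE -!mulgA s0n !mulgA ext_kC.
Qed.

Definition is_associated (s : H -> X) (g : H -> H -> N) : Prop :=
  (forall x, g x 1 = 1 /\ g 1 x = 1) /\
  (forall h h', k (g h h') * s (h * h') = s h * s h').

Lemma associated_factor_set s g :
  is_section s -> is_associated s g -> is_factor_set Phi g.
Proof.
move=> sP [g1 gE] phi phiE; split=> // x y z; apply/(data_rel sP).
rewrite !gmulfM -[LHS]mulgA gE mulgA gE -[in RHS](mulgA x) -[RHS]mulgA gE.
by rewrite [RHS]mulgA -(data_act sP phiE) -!mulgA gE.
Qed.

Lemma associated_ex : exists (s : H -> X) (g : factor_set Phi),
  is_section s /\ is_associated s g.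
Proof.
have [s sP] := ext_section X; have [se s1] := sP.
have [q qP] := ext_quotient_fun (@cx_cosetal _ X).
pose g h h' := if (h == 1) || (h' == 1) then 1 else q (s h * s h') (s (h * h')).
have gP : is_associated s g.
  split=> [x|h h']; first by rewrite /g eqxx orbT.
  rewrite /g; case: ifPn => [|_]; last by apply: qP; rewrite gmulfM !se.
  by case/orP=> /eqP->; rewrite gmulf1 s1 ?mul1g ?mulg1.
by exists s, (FactorSet (associated_factor_set sP gP)).
Qed.

End Independence.

Fact zeta_ex Phi (C : CExt Phi) : exists c : H2 Phi,
  exists (X : cosetal_ext Phi) (s : H -> X) (g : factor_set Phi),
    [/\ C X, is_section s, is_associated s g & H2class g = c].
Proof.
have [X <-] := cext_class_surj C; have [s [g [sP gP]]] := associated_ex X.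
by exists (H2class g), X, s, g; split=> //; apply: ext_iso_refl.
Qed.

Definition zeta Phi (C : CExt Phi) : H2 Phi := projT1 (cid (zeta_ex C)).

End CosetalExtensions.

Section FactorSetExtension.
Variables (N : abelianGroupType) (H : monoidType) (E : admissibleRel N H).
Variables (phi : compatibleAction E) (g : factor_set (action_class phi)).

(* An alias of {eq_quot E}, indexed by phi and g so that it can carry the
   multiplication they define. *)
Definition fs_mid : Type :=
  let _ := g in {eq_quot E}.
HB.instance Definition _ := Choice.copy fs_mid {eq_quot E}.

Definition fs_cls (p : N * H) : fs_mid := \pi_({eq_quot E}) p.
Definition fs_repr (c : fs_mid) : N * H := repr (c : {eq_quot E}).

Lemma fs_clsP p p' : fs_cls p = fs_cls p' <-> E p p'.
Proof. by rewrite /fs_cls; split=> [/eqmodP|Ep] //; apply/eqmodP. Qed.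

Lemma fs_reprK : cancel fs_repr fs_cls.
Proof. by move=> c; rewrite /fs_cls /fs_repr reprK. Qed.

Definition fs_pmul (p p' : N * H) : N * H :=
  (p.1 * phi p.2 p'.1 * g p.2 p'.2, p.2 * p'.2).

Definition fs_mmul (c c' : fs_mid) : fs_mid :=
  fs_cls (fs_pmul (fs_repr c) (fs_repr c')).

Lemma fs_pmul_cong p p' r r' : E p p' -> E r r' ->
  E (fs_pmul p r) (fs_pmul p' r').
Proof.
case: p p' r r' => [n h] [n' h'] [m l] [m' l'] Ep Er.
have C := act_compat phi.
rewrite /fs_pmul /=; move: Ep Er (adm_snd Ep) (adm_snd Er).
move=> Ep Er hh ll; rewrite -hh -ll in Ep Er *.
apply: admM; last exact: admE.
by apply: admM; [apply: adm_mulr | apply: (cmp_arg C)].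
Qed.

Lemma fs_clsM p p' : fs_mmul (fs_cls p) (fs_cls p') = fs_cls (fs_pmul p p').
Proof. by apply/fs_clsP/fs_pmul_cong; apply/fs_clsP; apply: fs_reprK. Qed.

Fact fs_mmulA : associative fs_mmul.
Proof.
move=> a b c; rewrite -(fs_reprK a) -(fs_reprK b) -(fs_reprK c).
rewrite !fs_clsM; apply/fs_clsP.
case: (fs_repr a) (fs_repr b) (fs_repr c) => [n x] [m y] [l z].
rewrite /fs_pmul /= mulgA; have C := act_compat phi.
have [_ gc] := factor_setP g.
have E1 : E (phi x (m * phi y l * g y z), x * y * z)
   (phi x m * phi (x * y) l * phi x (g y z), x * y * z).
  rewrite -(mulgA x).
  apply: adm_trans (adm_mulr (y * z) (cmp_mul C x _ _)) _.
  apply: admM; last exact: admE.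
  apply: adm_trans (adm_mulr (y * z) (cmp_mul C x _ _)) _.
  apply: admM; first exact: admE.
  by rewrite mulgA; apply/adm_sym/adm_mulr/(cmp_act C).
apply: adm_trans (admM (adm_mull n E1) (admE _ _)) _.
rewrite -!mulgA; do 2!apply: adm_mull; rewrite !mulgA.
apply: adm_sym; rewrite (mulgC (g x y)) -!mulgA; apply: adm_mull.
by rewrite !mulgA.
Qed.

Fact fs_mmul1g : left_id (fs_cls (1, 1)) fs_mmul.
Proof.
move=> a; rewrite -(fs_reprK a) fs_clsM /fs_pmul /=.
case: (fs_repr a) => n h /=; have [g1 _] := factor_setP g.
by rewrite !mul1g cmp_1actE (g1 h).2 mulg1.
Qed.

Fact fs_mmulg1 : right_id (fs_cls (1, 1)) fs_mmul.
Proof.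
move=> a; rewrite -(fs_reprK a) fs_clsM /fs_pmul /=.
case: (fs_repr a) => n h /=; have [g1 _] := factor_setP g.
rewrite mulg1 (g1 h).1 mulg1; apply/fs_clsP.
rewrite -[X in E _ (X, _)]mulg1; apply: adm_mull.
exact: (cmp_act1 (act_compat phi)).
Qed.

HB.instance Definition _ :=
  isMonoid.Build fs_mid fs_mmulA fs_mmul1g fs_mmulg1.

Lemma fs_mulE p p' : fs_cls p * fs_cls p' = fs_cls (fs_pmul p p').
Proof. exact: fs_clsM. Qed.

Definition fs_k_fun (n : N) : fs_mid := fs_cls (n, 1).
Definition fs_e_fun (c : fs_mid) : H := (fs_repr c).2.

Lemma fs_e_cls p : fs_e_fun (fs_cls p) = p.2.
Proof.
rewrite /fs_e_fun; have /fs_clsP := fs_reprK (fs_cls p).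
by move: (fs_repr _) => [n h]; case: p => n' h' /adm_snd.
Qed.

Lemma fs_cls_ind (P : fs_mid -> Prop) :
  (forall n h, P (fs_cls (n, h))) -> forall c, P c.
Proof. by move=> IP c; rewrite -(fs_reprK c); case: (fs_repr c). Qed.

Fact fs_k_morphism : monoid_morphism fs_k_fun.
Proof.
split=> // n n'; rewrite /fs_k_fun fs_mulE /fs_pmul /=.
by have [g1 _] := factor_setP g; rewrite cmp_1actE (g1 1).1 !mulg1.
Qed.

Fact fs_e_morphism : monoid_morphism fs_e_fun.
Proof.
split=> [|]; first exact: fs_e_cls.
elim/fs_cls_ind=> n h; elim/fs_cls_ind=> n' h'.
by rewrite fs_mulE !fs_e_cls.
Qed.

Definition fs_k : UMagmaMorphism.type N fs_mid := mk_hom fs_k_morphism.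
Definition fs_e : UMagmaMorphism.type fs_mid H := mk_hom fs_e_morphism.

Lemma fs_kM n h : fs_k n * fs_cls (1, h) = fs_cls (n, h).
Proof.
rewrite /= /fs_k_fun fs_mulE /fs_pmul /= cmp_1actE.
by have [g1 _] := factor_setP g; rewrite (g1 h).2 mul1g !mulg1.
Qed.

Fact fs_kernel : is_kernel fs_k fs_e.
Proof.
split=> [n n' /fs_clsP/adm_inj //|]; elim/fs_cls_ind=> n h.
rewrite /= fs_e_cls /=; split=> [->|[n' /fs_clsP/adm_snd //]].
by exists n.
Qed.

Fact fs_cokernel : is_cokernel fs_k fs_e.
Proof.
move=> M f fk; have fE n h : f (fs_cls (n, h)) = f (fs_cls (1, h)).
  by rewrite -(fs_kM n h) gmulfM fk mul1g.
have lP : monoid_morphism (fun h => f (fs_cls (1, h))).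
  split=> [|x y]; first exact: gmulf1.
  by rewrite -gmulfM fs_mulE /fs_pmul [RHS]fE.
exists (mk_hom lP).
  by elim/fs_cls_ind=> n h /=; rewrite fE fs_e_cls.
by move=> l' l'E h /=; rewrite l'E /= fs_e_cls.
Qed.

Definition fs_ext : extension N H := Extension fs_kernel fs_cokernel.

Fact fs_cosetal : cosetal fs_ext.
Proof.
elim/fs_cls_ind=> n h; elim/fs_cls_ind=> n' h' nn.
have {nn} -> : h = h' by move: nn; rewrite /= !fs_e_cls.
exists (n / n'); rewrite -(fs_kM n') mulgA.
by rewrite -(gmulfM (s := fs_k)) mulgVK fs_kM.
Qed.

Fact fs_data : has_data fs_ext (action_class phi).
Proof.
have sP : @is_section _ _ fs_ext (fun h => fs_cls (1, h)).
  by split=> [h|//]; apply: fs_e_cls.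
have [q qP] := ext_quotient_fun fs_cosetal.
have qE h n : E (phi h n, h) (section_action (fun h => fs_cls (1, h) : fs_ext) q h n, h).
  have [g1 _] := factor_setP g.
  apply/fs_clsP; rewrite -(fs_kM (section_action _ _ _ _)); apply/esym.
  rewrite /section_action (qP (fs_cls (1, h) * fs_k n)).
    rewrite /= /fs_k_fun fs_mulE /fs_pmul /= (g1 h).1.
    by rewrite mul1g !mulg1.
  by rewrite gmulfM (ext_ek fs_ext) mulg1.
have C := act_compat phi.
have qc : compatible E (section_action (fun h => fs_cls (1, h) : fs_ext) q).
  split.
  - by move=> n1 n2 n h En; apply: admM => //; apply: admE.
  - move=> n n' h h' En.
    apply: adm_trans (adm_mulr h' (adm_sym (qE h n))) _.
    by apply: adm_trans (cmp_arg C h En) _; apply/adm_mulr/qE.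
  - move=> h n n'; apply: adm_trans (adm_sym (qE _ _)) _.
    apply: adm_trans (cmp_mul C _ _ _) _.
    by apply: admM; apply/qE.
  - move=> h h' n; apply: adm_trans (adm_sym (qE _ _)) _.
    apply: adm_trans (cmp_act C _ _ _) _.
    apply: adm_trans (cmp_arg C h (qE h' n)) _.
    exact/adm_mulr/qE.
  - by move=> h; apply: adm_trans (adm_sym (qE _ _)) (cmp_act1 C h).
  - by move=> n; apply: adm_trans (adm_sym (qE _ _)) (cmp_1act C n).
exists (fun h => fs_cls (1, h)), q; split=> //.
  by move=> n n' h h'; rewrite !fs_kM; apply: iff_sym; apply: fs_clsP.
exists (CompatibleAction qc) => //.
by apply/action_classP=> h n; apply/adm_sym/qE.
Qed.

Definition fs_cosetal_ext : cosetal_ext (action_class phi) :=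
  CosetalExt fs_cosetal fs_data.

End FactorSetExtension.

Arguments fs_cosetal_ext {N H E} phi g.

Definition rho (N : abelianGroupType) (H : monoidType) (E : admissibleRel N H)
    (phi : compatibleAction E) (c : H2 (action_class phi)) :
    CExt (action_class phi) :=
  cext_class (fs_cosetal_ext phi (repr (repr c : Fgroup (action_class phi)))).

Arguments rho {N H E} phi c.
Arguments zeta {N H E Phi} C.

(* Main.v *)
Require Import Defs.
From HB Require Import structures.
From mathcomp Require Import all_boot.
From mathcomp Require Import boolp.

(* A normalized g : H x H -> N is associated to a section s of a cosetal
   extension X exactly when [n, h] |-> k(n) s(h) is an isomorphism from the
   extension built from g onto X.  Changing the section by t : H -> N changes
   the associated factor set by delta t (up to F), and every cohomologous factor
   set arises in this way; hence cohomology classes and isomorphism classes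
   determine each other. *)

Local Open Scope group_scope.

Section Correspondence.
Set Implicit Arguments.
Unset Strict Implicit.
Context {H : monoidType} {N : abelianGroupType} {E : admissibleRel N H}.
Context {phi : compatibleAction E}.
Implicit Types (X Y : cosetal_ext (action_class phi)).
Implicit Types (g : factor_set (action_class phi)).

Lemma ext_kxk X (s : H -> X) : is_section s -> forall a b h h',
  ext_k X a * s h * (ext_k X b * s h') =
  ext_k X (a * phi h b) * (s h * s h').
Proof.
move=> sP a b h h'.
by rewrite gmulfM -!mulgA (mulgA (s h)) (data_act sP erefl) -!mulgA.
Qed.

Lemma associated_iso X (s : H -> X) g :
  is_section s -> is_associated s g -> ext_iso (fs_ext g) X.
Proof.
move=> sP [g1 gE]; have [se s1] := sP.
pose f (c : fs_ext g) : X := ext_k X (fs_repr c).1 * s (fs_repr c).2.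
have fE n h : f (fs_cls g (n, h)) = ext_k X n * s h.
  (* [f] is computed on a chosen representative; the choice is harmless because [E] is exactly the
     relation that [s] induces. *)
  have /fs_clsP := fs_reprK (fs_cls g (n, h)).
  rewrite /f; by case: (fs_repr _) => n' h' /(data_rel sP).
have fM : monoid_morphism f.
  split; first by rewrite fE gmulf1 s1 mulg1.
  elim/fs_cls_ind=> n h; elim/fs_cls_ind=> n' h'.
  by rewrite fs_mulE fE !fE /= (ext_kxk sP) -gE mulgA -gmulfM.
exists (mk_hom fM); split=> [|n|] /=.
- have [q qP] := ext_quotient_fun (@cx_cosetal _ _ _ _ X).
  (* The inverse comes from cosetality: [x] and [s (e x)] lie over the same element, so [q] supplies
     the coefficient of [x]. *)
  exists (fun x => fs_cls g (q x (s (ext_e X x)), ext_e X x)).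
    elim/fs_cls_ind=> n h; apply/fs_clsP/(data_rel sP); rewrite qP ?se //.
  by move=> x; rewrite fE qP ?se.
- by rewrite /fs_k_fun fE s1 mulg1.
- by elim/fs_cls_ind=> n h; rewrite fE fs_e_cls gmulfM ext_ek mul1g se.
Qed.

(** The isomorphism [f] turns [s] into the section [f \o s] of [Y], still with factor set [g];
    cosetality of [Y] gives [t] relating it to [s']. *)
Lemma iso_H2class X Y (s : H -> X) (s' : H -> Y) g g' :
  is_section s -> is_associated s g ->
  is_section s' -> is_associated s' g' ->
  ext_iso X Y -> H2class g = H2class g'.
Proof.
move=> [se s1] [_ gE] sP' [_ gE'] [f [_ fk fe]]; have [se' s1'] := sP'.
have [q qP] := ext_quotient_fun (@cx_cosetal _ _ _ _ Y).
pose t h := if h == 1 then 1 else q (f (s h)) (s' h).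
have t1 : t 1 = 1 by rewrite /t eqxx.
have tE h : ext_k Y (t h) * s' h = f (s h).
  rewrite /t; case: eqP => [->|_]; first by rewrite s1 s1' !gmulf1 mulg1.
  by apply: qP; rewrite fe se se'.
apply/H2classP; rewrite -FclassV -FclassM.
apply: (IFP _ (phi := phi) t1) => // h h'.
(* Under [(n, x) |-> k(n) s'(x)] both sides go to [f (s h * s h')]. *)
have Eg : E (g h h' * t (h * h'), h * h')
            (t h * phi h (t h') * g' h h', h * h').
  apply/(data_rel sP'); rewrite !(gmulfM (s := ext_k Y)) -!mulgA tE gE'.
  rewrite mulgA -gmulfM -(ext_kxk sP') !tE.
  by rewrite -fk -!gmulfM gE.
have := admM Eg (admE E ((t (h * h'))^-1 * (g' h h')^-1, h * h')).
rewrite mulgA mulgK; congr (is_true (E _ (_, _))).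
by rewrite /delta mulgACA mulgV mulg1 -mulgA mulgC.
Qed.

(** The section is [h |-> [t h, h]]; the hypothesis is its association with [g], read through the
    multiplication defined by [g']. *)
Lemma fs_associated_translate g g' (t : H -> N) : t 1 = 1 ->
  (forall h h', E (g h h' * t (h * h'), h * h')
                  (t h * phi h (t h') * g' h h', h * h')) ->
  exists s : H -> fs_cosetal_ext phi g',
    is_section s /\
    is_associated s g.
Proof.
move=> t1 gE; exists (fun h => fs_cls g' (t h, h)); split.
  by split=> [h|]; [apply: fs_e_cls | rewrite t1].
split=> [x|h h']; first by have [g1 _] := factor_setP g; apply: g1.
rewrite -(fs_kM g' (t (h * h'))) mulgA -(gmulfM (s := fs_k g')) fs_kM.
by rewrite fs_mulE; apply/fs_clsP; apply: gE.
Qed.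

Lemma fs_associated g : exists s : H -> fs_cosetal_ext phi g,
  is_section s /\
  is_associated s g.
Proof.
apply: (@fs_associated_translate _ _ (fun=> 1)) => // h h'.
rewrite mulg1 mul1g -[X in E (X, _) _]mul1g; apply: admM; last exact: admE.
exact/adm_mulr/adm_sym/(cmp_act1 (act_compat phi)).
Qed.

Lemma H2class_iso g g' : H2class g = H2class g' ->
  ext_iso (fs_cosetal_ext phi g) (fs_cosetal_ext phi g').
Proof.
move=> /H2classP /asboolP[d [psi [t [psiE t1 dE]]]].
rewrite -FclassV -FclassM => /FclassP dgg'.
have [|s [sP gP]] := @fs_associated_translate g g' t t1.
  move=> h h'.
  (* The inner factor set may use another representative [psi] of the action class; [delta] then
     changes only up to [E]. *)
  have Ed : E (g h h' * (g' h h')^-1, h * h') (delta phi t h h', h * h').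
    apply: adm_trans (adm_sym (dgg' h h')) _.
    by rewrite dE; apply: delta_class.
  have := admM Ed (admE E (t (h * h') * g' h h', h * h')).
  rewrite (mulgC (t _)) mulgA mulgVK; congr (is_true (E _ (_, _))).
  by rewrite (mulgC (g' h h')) mulgA; congr (_ * _); rewrite /delta mulgAC mulgVK mulgC.
exact: associated_iso sP gP.
Qed.

(** [rho] evaluates at chosen representatives, so this is its independence of that choice. *)
Lemma rho_H2class g :
  rho phi (H2class g) = cext_class (fs_cosetal_ext phi g).
Proof.
by apply/cext_classP/H2class_iso; rewrite /H2class /Fclass !reprK.
Qed.

(** [zeta] picks some extension, section and factor set by choice; [iso_H2class] compares them with
    the given ones. *)
Lemma zeta_cext_class X (s : H -> X) g :
  is_section s -> is_associated s g -> zeta (cext_class X) = H2class g.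
Proof.
move=> sP gP; rewrite /zeta.
case: (cid _) => c /= [Y [s' [g' [XY sP' gP' <-]]]].
exact/esym/(iso_H2class sP gP sP' gP').
Qed.

Lemma rhoK : cancel (rho phi) zeta.
Proof.
move=> c; have [g <-] := H2class_surj c; have [s [sP gP]] := fs_associated g.
by rewrite rho_H2class; apply: zeta_cext_class sP gP.
Qed.

Lemma zetaK : cancel zeta (rho phi).
Proof.
move=> C; have [X <-] := cext_class_surj C.
have [s [g [sP gP]]] := associated_ex X.
rewrite (zeta_cext_class sP gP) rho_H2class.
exact/cext_classP/(associated_iso sP gP).
Qed.

End Correspondence.

Theorem theorem4p21 (H : monoidType) (N : abelianGroupType)
    (E : admissibleRel N H) (phi : compatibleAction E) :
  [/\ forall g : factor_set (action_class phi),
        rho phi (H2class g) = cext_class (fs_cosetal_ext phi g),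
      forall (X : cosetal_ext (action_class phi)) (s : H -> X)
             (g : factor_set (action_class phi)),
        is_section s -> is_associated s g ->
        zeta (cext_class X) = H2class g,
      cancel (rho phi) zeta,
      cancel zeta (rho phi) &
      bijective (rho phi)].
Proof.
split; [exact: rho_H2class|exact: zeta_cext_class|exact: rhoK|exact: zetaK|].
by exists zeta; [exact: rhoK|exact: zetaK].
Qed.
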